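(* For every odd $n\ge 5$, the $(1,3)$-biased Clique game on $K_n$ is won by player $2$.
   Context: Two players, Alice (player 1, starting) and Bob (player 2), alternately colour uncoloured edges of the complete graph $K_n$, Alice in red and Bob in blue. In the $(p,q)$-biased version Alice colours $p$ edges on each of her turns and Bob colours $q$ edges on each of his turns. In the Clique game, at the end Alice's score is $a=\omega(G[A])$ and Bob's score is $b=\omega(G[B])$, the clique numbers of the graphs formed by the red edges $A$ and the blue edges $B$. When $q>p$, Bob (player 2) wins if at the end $b>a$. Here $(p,q)=(1,3)$. *)

(* Defs.v *)
From mathcomp Require Import all_boot.

Set Implicit Arguments.
Unset Strict Implicit.
Unset Printing Implicit Defensive.

Definition edges (n : nat) : {set {set 'I_n}} := [set e : {set 'I_n} | #|e| == 2].

Definition clique (n : nat) (E : {set {set 'I_n}}) (S : {set 'I_n}) : bool :=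
  [forall x in S, forall y in S, (x != y) ==> ([set x; y] \in E)].

(* Clique number of the graph on all of 'I_n with edge set E: it is 1, not 0,
   when E is empty and n > 0. *)
Definition clique_number (n : nat) (E : {set {set 'I_n}}) : nat :=
  \max_(S : {set 'I_n} | clique E S) #|S|.

(* A history lists the sets of edges coloured on the successive turns. Turns are
   numbered from 0: player 1 (red) moves on even turns, player 2 (blue) on odd
   turns. *)
Definition history (n : nat) : Type := seq {set {set 'I_n}}.

Definition red (n : nat) (h : history n) : {set {set 'I_n}} :=
  \bigcup_(i < size h | ~~ odd i) nth set0 h i.

Definition blue (n : nat) (h : history n) : {set {set 'I_n}} :=
  \bigcup_(i < size h | odd i) nth set0 h i.

Definition uncoloured (n : nat) (h : history n) : {set {set 'I_n}} :=
  edges n :\: (red h :|: blue h).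

(* A player entitled to k edges colours exactly k of them, except that if fewer
   than k are left, all the remaining ones are coloured. *)
Definition legal_move (n k : nat) (h : history n) (m : {set {set 'I_n}}) : bool :=
  [&& uncoloured h != set0, m \subset uncoloured h
    & #|m| == minn k #|uncoloured h|].

Definition legal_history (p q n : nat) (h : history n) : Prop :=
  forall i : nat, i < size h ->
    legal_move (if odd i then q else p) (take i h) (nth set0 h i).

Definition strategy (n : nat) : Type := history n -> {set {set 'I_n}}.

Definition player2_follows (n : nat) (s : strategy n) (h : history n) : Prop :=
  forall i : nat, i < size h -> odd i -> nth set0 h i = s (take i h).

(* Without this condition an illegal strategy would win vacuously, as no complete
   legal play would follow it. *)
Definition player2_legal_strategy (p q n : nat) (s : strategy n) : Prop :=
  forall h : history n,
    legal_history p q h -> player2_follows s h ->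
    odd (size h) -> uncoloured h != set0 -> legal_move q h (s h).

(* The strict inequality between the scores is the winning condition of player 2
   in the case p < q. *)
Definition clique_game_won_by_player2 (p q n : nat) : Prop :=
  exists2 s : strategy n, player2_legal_strategy p q s
    & forall h : history n,
        legal_history p q h -> player2_follows s h -> uncoloured h = set0 ->
        clique_number (red h) < clique_number (blue h).

(* Main.v *)
(** Bob reacts to Alice's first edge by fixing an involution s of the vertices
    with exactly one fixed point v, such that this first edge is {x, s x}.
    Afterwards he always colours the "threatened" edges: each red edge forces a
    few edges blue, roughly the other edges of its orbit under applying s to
    either endpoint, and one new red edge never creates more than 3 threats.
    At the end there is a blue triangle, and a red clique K with at least 3
    vertices contains no pair {y, s y}, so its mirror image s(K) is a blue clique
    of the same size.  The latter extends by one vertex: by x if v is in K;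
    otherwise by some y in K with {y, s y} blue; and by v if there is no such y. *)
Require Import Defs.
From mathcomp Require Import all_boot.
From mathcomp Require Import perm.
Set Implicit Arguments.
Unset Strict Implicit.
Unset Printing Implicit Defensive.

(** * Edges as pairs of vertices, cliques and the clique number *)

Lemma edgeE n (u w : 'I_n) : ([set u; w] \in edges n) = (u != w).
Proof. by rewrite inE cards2; case: (u != w). Qed.

Lemma set2_eq (T : finType) (a b c d : T) :
  ([set a; b] == [set c; d]) = ((a == c) && (b == d)) || ((a == d) && (b == c)).
Proof.
apply/idP/orP=> [|[]/andP[/eqP-> /eqP->] //]; last by rewrite setUC.
rewrite eqEsubset !subUset !sub1set !inE.
rewrite (eq_sym c a) (eq_sym c b) (eq_sym d a) (eq_sym d b).
by case: (a == c); case: (a == d); case: (b == c); case: (b == d); auto.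
Qed.

Lemma clique_number_ge n (E : {set {set 'I_n}}) S :
  clique E S -> #|S| <= clique_number E.
Proof. by move=> h; rewrite /clique_number (bigD1 S) //= leq_maxl. Qed.

Lemma cliqueP n (E : {set {set 'I_n}}) (S : {set 'I_n}) :
  reflect {in S &, forall u w, u != w -> [set u; w] \in E} (clique E S).
Proof.
apply: (iffP forallP) => h.
  move=> u w uS wS.
  by have /implyP/(_ uS)/forallP/(_ w)/implyP/(_ wS)/implyP := h u.
move=> u; apply/implyP=> uS; apply/forallP=> w; apply/implyP=> wS; apply/implyP.
exact: h.
Qed.

Lemma cliqueU1 n (E : {set {set 'I_n}}) y (S : {set 'I_n}) :
  clique E S -> {in S, forall u, [set y; u] \in E} -> clique E (y |: S).
Proof.
move=> /cliqueP hS hy; apply/cliqueP=> u w /setU1P[->|uS] /setU1P[->|wS] uw.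
- by rewrite eqxx in uw.
- exact: hy.
- by rewrite setUC; apply: hy.
- exact: hS.
Qed.

(** * Safe positions relative to an involution [s] with fixed point [v] *)

Section Safe.
Variables (n : nat) (v x : 'I_n) (s : 'I_n -> 'I_n).
Implicit Types A B D K : {set {set 'I_n}}.

(* A is red and B is blue.  Letting x be joined in red to both w and s w, provided
   that {w, s w} is blue, is what makes it affordable (3 answers per red edge) to
   have {x, s w} blue whenever {v, w} is red. *)
Definition safe A B : bool :=
  [&& [set x; s x] \in A, [set v; x] \in B, [set v; s x] \in B,
    [forall u, ([set v; u] \in A) ==>
      [&& [set v; s u] \in B, [set u; s u] \in B & [set x; s u] \in B]],
    [forall u, ([set u; s u] \in A) ==> ([set v; u] \in B)],
    [forall u, ([set x; u] \in A) ==>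
      [&& [set v; s u] \in B,
        ([set x; s u] \in A) ==> ([set u; s u] \in B)
        & ([set u; s u] \in A) && (u != s x) ==> ([set x; s u] \in B)]] &
    [forall u, forall w,
      [&& [set u; w] \in A, u != v, w != v & w != s u] ==>
      ([set s u; s w] \in B) && ((w != x) ==> ([set s u; w] \in B))]].

Record safe_spec A B : Prop := SafeSpec {
  safe_xx : [set x; s x] \in A;
  safe_vx : [set v; x] \in B;
  safe_vsx : [set v; s x] \in B;
  safe_v u : [set v; u] \in A ->
    [/\ [set v; s u] \in B, [set u; s u] \in B & [set x; s u] \in B];
  safe_s u : [set u; s u] \in A -> [set v; u] \in B;
  safe_x u : [set x; u] \in A -> [set v; s u] \in B;
  safe_xsu u : [set x; u] \in A -> [set x; s u] \in A -> [set u; s u] \in B;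
  safe_usu u : [set x; u] \in A -> [set u; s u] \in A -> u != s x ->
    [set x; s u] \in B;
  safe_ss u w : [set u; w] \in A -> u != v -> w != v -> w != s u ->
    [set s u; s w] \in B;
  safe_sw u w : [set u; w] \in A -> u != v -> w != v -> w != s u -> w != x ->
    [set s u; w] \in B }.

Lemma safeP A B : reflect (safe_spec A B) (safe A B).
Proof.
apply: (iffP idP) => [|[h1 h2 h3 h4 h5 h6 h7 h8 h9 h10]].
  case/and5P=> h1 h2 h3 /forallP h4 /and3P[/forallP h5 /forallP h6 /forallP h7].
  split=> // [u /(implyP (h4 u))/and3P[]|u /(implyP (h5 u))
             |u /(implyP (h6 u))/and3P[]
             |u /(implyP (h6 u))/and3P[_ /implyP]
             |u /(implyP (h6 u))/and3P[_ _ /implyP h] a b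
             |u w a b c d|u w a b c d e] //.
  - by apply: h; rewrite a.
  - by have /forallP/(_ w)/implyP/(_ _)/andP[|] := h7 u; rewrite ?a ?b ?c.
  - have /forallP/(_ w)/implyP/(_ _)/andP[|_ /implyP] := h7 u; last exact.
    by rewrite a b c.
rewrite /safe h1 h2 h3 /=; apply/and4P; split.
- by apply/forallP=> u; apply/implyP=> /h4[-> -> ->].
- by apply/forallP=> u; apply/implyP=> /h5.
- apply/forallP=> u; apply/implyP=> a; rewrite h6 //=; apply/andP; split.
    by apply/implyP; exact: h7.
  by apply/implyP=> /andP[]; exact: h8.
apply/forallP=> u; apply/forallP=> w; apply/implyP=> /and4P[a b c d].
by rewrite h9 //=; apply/implyP; exact: h10.
Qed.

(** Blue edges occur only in the conclusions of the rules. Hence the surplus edges that Bob has to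
    colour do no harm. *)
Lemma safe_mono A B B' : B \subset B' -> safe A B -> safe A B'.
Proof.
move=> /subsetP sB /safeP[h1 h2 h3 h4 h5 h6 h7 h8 h9 h10].
apply/safeP; split=> //.
all: try by move=> *; apply: sB; eauto.
by move=> u /h4[? ? ?]; split; exact: sB.
Qed.

Hypotheses (sK : involutive s) (s_fix : forall u, (s u == u) = (u == v)).
Hypothesis (xNv : x != v).

Let sv : s v = v. Proof. by apply/eqP; rewrite s_fix. Qed.
Let s_inj : injective s := can_inj sK.
Let sNv u : (s u == v) = (u == v).
Proof. by rewrite -{1}sv (inj_eq s_inj). Qed.
Let s_eqC u w : (s u == w) = (u == s w).
Proof. by rewrite -{1}[w]sK (inj_eq s_inj). Qed.

(** * Complete safe colourings have the larger clique in blue *)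

Lemma safe_clique A B (K : {set 'I_n}) : 5 <= n ->
  [disjoint A & B] -> A :|: B = edges n -> safe A B -> clique A K ->
  exists2 S, clique B S & #|K| < #|S|.
Proof.
move=> n5 dAB cAB /safeP[hxx hvx hvsx hv hs hx hxsu husu hss hsw] /cliqueP cK.
have AB e : e \in A -> e \in B -> False.
  by move=> eA eB; have := disjointFr dAB eA; rewrite eB.
have ABe u w : u != w -> [set u; w] \notin A -> [set u; w] \in B.
  by rewrite -edgeE -cAB inE => /orP[->|].
(* Here a blue triangle suffices: [v], a vertex [y] outside [{v, x, s x}], and one of [x], [s x]. *)
have [K2|K3] := leqP #|K| 2.
  have [y] : exists y, y \notin [set v; x; s x].
    apply/existsP; rewrite -negb_forall; apply: contraL n5 => /forallP h.
    have : #|'I_n| <= #|[set v; x; s x]|.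
      by apply: subset_leq_card; apply/subsetP=> u _; apply: h.
    rewrite card_ord -ltnNge => /leq_ltn_trans; apply.
    by rewrite -setUA !cardsU1 cards1 !inE; do 2!case: (~~ _).
  (* If [{v, y}] is red, then [{v, s y}] is blue, and [s y] avoids [v], [x], [s x] as well. *)
  wlog vy : y / [set v; y] \in B => [th|].
    rewrite !inE !negb_or -andbA => /and3P[yv yx ysx].
    have [/hv[vsy _ _]|vy] := boolP ([set v; y] \in A).
      apply: (th (s y)) => //; rewrite !inE !negb_or sNv yv.
      by rewrite s_eqC ysx (inj_eq s_inj) yx.
    apply: (th y); last by rewrite !inE !negb_or yv yx ysx.
    by apply: ABe => //; rewrite eq_sym.
  rewrite !inE !negb_or -andbA => /and3P[yv yx ysx].
  suff [z [zv zy vz zyB]] : exists z, [/\ z != v, z != y, [set v; z] \in B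
      & [set z; y] \in B].
    exists [set v; z; y].
      apply/cliqueP=> a b; rewrite !inE -!orbA => /or3P[]/eqP-> /or3P[]/eqP->;
      by rewrite ?eqxx // setUC.
    by rewrite -setUA !cardsU1 cards1 !inE negb_or zy ![v == _]eq_sym zv yv.
  have [xy|xy] := boolP ([set x; y] \in A).
    exists (s x); rewrite sNv; split=> //; first by rewrite eq_sym.
    exact: hsw.
  by exists x; split=> //; [rewrite eq_sym | apply: ABe; rewrite // eq_sym].
(* A third vertex [z] of [K] would close a red triangle on [u], [s u]. The rules forbid it:
   [{u, s u}] is blue if [z] is [v] or [x], and [{z, s u}] is blue otherwise. *)
have Kss u w : u \in K -> w \in K -> u != v -> w != s u.
  move=> uK wK uv; apply/eqP=> wE; subst w.
  have uu : [set u; s u] \in A by apply: cK; rewrite // eq_sym s_fix.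
  have : 0 < #|K :\: [set u; s u]|.
    rewrite cardsD subn_gt0 (leq_ltn_trans _ K3) //.
    rewrite (leq_trans (subset_leq_card (subsetIr _ _))) // cards2.
    by case: (_ != _).
  case/card_gt0P=> z; rewrite !inE negb_or -andbA => /and3P[zu zsu zK].
  have zuA : [set z; u] \in A by exact: cK.
  have zsuA : [set z; s u] \in A by exact: cK.
  have [zv|zv] := eqVneq z v.
    by subst z; have [_ ? _] := hv _ zuA; exact: AB uu _.
  have [zx|zx] := eqVneq z x.
    by subst z; exact: AB uu (hxsu _ _ _).
  apply: (AB _ zsuA); rewrite setUC; apply: hsw => //; rewrite 1?setUC //.
have sKc : clique B (s @: K).
  apply/cliqueP=> _ _ /imsetP[u uK ->] /imsetP[w wK ->].
  rewrite (inj_eq s_inj) => uw.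
  have uwA := cK _ _ uK wK uw.
  have [uv|uv] := eqVneq u v.
    by subst u; have [+ _ _] := hv _ uwA; rewrite sv.
  have [wv|wv] := eqVneq w v.
    subst w; rewrite setUC in uwA; have [+ _ _] := hv _ uwA.
    by rewrite sv setUC.
  by apply: hss => //; exact: Kss.
(* That [s y] is outside [K] means that [y] is outside [s @: K], so adding [y] gains a vertex. *)
have ext y : s y \notin K -> {in K, forall u, [set y; s u] \in B} ->
    exists2 S, clique B S & #|K| < #|S|.
  move=> yK hy; exists (y |: s @: K).
    by apply: cliqueU1 => // _ /imsetP[u uK ->]; exact: hy.
  rewrite cardsU1 card_imset // -[y]sK mem_imset //.
  by rewrite yK.
have [vK|vK] := boolP (v \in K).
  have vK' u : u \in K -> u != v -> [set v; u] \in A.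
    by move=> *; apply: cK; rewrite // eq_sym.
  apply: (ext x); first by apply/negP=> /vK'; rewrite sNv => /(_ xNv)/AB.
  move=> u uK; have [->|uv] := eqVneq u v; first by rewrite sv setUC.
  by have [] := hv _ (vK' _ uK uv).
have KNv u : u \in K -> u != v by apply: contraTneq => ->.
have [/exists_inP[y yK yA]|] := boolP [exists y in K, [set y; s y] \notin A].
  have yv := KNv _ yK.
  have yB : [set y; s y] \in B by apply: ABe; rewrite // eq_sym s_fix.
  apply: (ext y); first by apply/negP=> /(Kss _ _ yK)/(_ yv); rewrite eqxx.
  move=> u uK; have [->//|uy] := eqVneq u y.
  rewrite setUC; apply: hsw; rewrite ?KNv //; first exact: cK.
  - by apply: Kss => //; apply: KNv.
  (* The rule used has an exception at [x], but [y] is not [x] because [{x, s x}] is red. *)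
  - by apply: contraNneq yA => ->.
rewrite negb_exists_in => /forall_inP hK.
apply: (ext v); first by rewrite sv.
move=> u /hK; rewrite negbK => uA; apply: hs; by rewrite sK setUC.
Qed.

Lemma safe_win A B : 5 <= n -> [disjoint A & B] -> A :|: B = edges n ->
  safe A B -> clique_number A < clique_number B.
Proof.
move=> n5 dAB cAB sAB.
have c0 : clique A set0 by apply/cliqueP=> u w; rewrite inE.
rewrite {1}/clique_number (bigmax_eq_arg _ c0) //=.
case: arg_maxnP => // K cK _.
have [S /clique_number_ge h] := safe_clique n5 dAB cAB sAB cK.
by move=> /leq_trans; apply.
Qed.

(** * Restoring safety after one new red edge *)

(** By monotonicity only instances of the rules with [e] among their premises are new. In the rule
    with premises [{x, u}] and [{u, s u}], [e] can play either part, whence both the third and the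
    fourth condition. *)
Lemma safe_setU1 A B (C : {set {set 'I_n}}) (e : {set 'I_n}) :
  safe A B -> B \subset C -> A \subset edges n ->
  e \in edges n -> e \notin B ->
  (forall u, e = [set v; u] ->
    [/\ [set v; s u] \in C, [set u; s u] \in C & [set x; s u] \in C]) ->
  (forall u, e = [set u; s u] -> [set v; u] \in C) ->
  (forall u, e = [set x; u] -> u != v -> u != s x ->
    [/\ [set v; s u] \in C, [set x; s u] \in A -> [set u; s u] \in C
      & [set u; s u] \in A -> [set x; s u] \in C]) ->
  (forall u, e = [set u; s u] -> [set x; u] \in A -> u != s x ->
    [set x; s u] \in C) ->
  (forall u w, e = [set u; w] -> u != v -> w != v -> u != w -> w != s u ->
    [set s u; s w] \in C /\ (w != x -> [set s u; w] \in C)) ->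
  safe (e |: A) C.
Proof.
move=> sAB BC AE eE eB c1 c2 c3 c4 c5.
have /safeP[hxx hvx hvsx hv hs hx hxsu husu hss hsw] := safe_mono BC sAB.
have xvB : [set x; v] \in B by rewrite setUC; case/safeP: sAB.
(* The values left out of the third condition are harmless: [{x, v}] is blue, hence not [e], and for
   [u = s x] the edge [{v, s u}] is the blue [{v, x}]. *)
have c3' u : e = [set x; u] ->
    [/\ [set v; s u] \in C, [set x; s u] \in A -> [set u; s u] \in C
      & [set u; s u] \in A -> u != s x -> [set x; s u] \in C].
  move=> eu; have uv : u != v by apply: contraNneq eB => uv; rewrite eu uv.
  have [->|ux] := eqVneq u (s x); last first.
    by have [p q r] := c3 _ eu uv ux; split=> // a _; exact: r.
  rewrite sK; split=> // xA.
  by have := subsetP AE _ xA; rewrite edgeE eqxx.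
apply/safeP; split=> //.
- exact: setU1r.
- by move=> u /setU1P[/esym/c1|/hv].
- by move=> u /setU1P[/esym/c2|/hs].
- by move=> u /setU1P[/esym/c3'[]|/hx].
- move=> u /setU1P[/esym eu|uA] /setU1P[/esym eu'|uA'].
  + move: eu' eB; rewrite eu => /eqP; rewrite set2_eq eqxx /=.
    case/orP=> [|/andP[_ /eqP ux]].
      by rewrite eq_sym s_fix => /eqP ->; rewrite xvB.
    by have := eE; rewrite eu ux edgeE eqxx.
  + by have [_ + _] := c3' _ eu; apply.
  + by have [_ + _] := c3' _ eu'; rewrite sK (setUC [set s u]); apply.
  + exact: hxsu.
- move=> u /setU1P[/esym eu|uA] /setU1P[/esym eu'|uA'] ux.
  + move: eu'; rewrite eu => /eqP.
    rewrite set2_eq eqxx andbT (eq_sym u (s u)) s_fix.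
    case/orP=> [/andP[/eqP xu /eqP uv]|/eqP xu].
      by have := xNv; rewrite xu uv eqxx.
    by rewrite xu sK eqxx in ux.
  + by have [_ _] := c3' _ eu; apply.
  + exact: c4.
  + exact: husu.
- move=> u w /setU1P[/esym eu|uA] uv wv wu; last exact: hss.
  have uw : u != w by rewrite -edgeE -eu.
  by have [] := c5 _ _ eu uv wv uw wu.
- move=> u w /setU1P[/esym eu|uA] uv wv wu; last exact: hsw.
  have uw : u != w by rewrite -edgeE -eu.
  by have [] := c5 _ _ eu uv wv uw wu.
Qed.

(** Packed as a tuple of rewrite rules, so that one [rewrite] decides any comparison among the five
    vertices [v], [a], [s a], [b], [s b]. *)
Lemma distinct5 a b : a != v -> b != v -> b != a -> b != s a ->
  ((v == a) = false) * ((v == s a) = false) * ((v == b) = false) *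
  ((v == s b) = false) * ((a == v) = false) * ((a == s a) = false) *
  ((a == b) = false) * ((a == s b) = false) * ((s a == v) = false) *
  ((s a == a) = false) * ((s a == b) = false) * ((s a == s b) = false) *
  ((b == v) = false) * ((b == a) = false) * ((b == s a) = false) *
  ((b == s b) = false) * ((s b == v) = false) * ((s b == a) = false) *
  ((s b == s a) = false) * ((s b == b) = false).
Proof.
move=> /negPf av /negPf bv /negPf ba /negPf bsa.
have ab : (a == b) = false by rewrite eq_sym.
have asb : (a == s b) = false by rewrite -s_eqC eq_sym.
have E := (av, bv, ba, bsa, ab, asb).
by do !split; rewrite ?(inj_eq s_inj) ?sNv ?s_fix ?s_eqC ?E //
  eq_sym ?sNv ?s_fix ?E.
Qed.

(** No threat can be red already: the rules are reversible enough that a red threat would have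
    forced [e] to be blue. The count of 3 is checked for edges at [v], edges [{u, s u}], edges at
    [x], and all others. [D] may overlap [B]. *)
Lemma safe_step A B (e : {set 'I_n}) : [disjoint A & B] -> A \subset edges n ->
  e \in edges n -> e \notin A -> e \notin B -> safe A B ->
  exists D, [/\ #|D| <= 3, D \subset edges n, [disjoint D & e |: A]
    & safe (e |: A) (B :|: D)].
Proof.
move=> dAB AE eE eA eB sAB.
have AB f : f \in A -> f \in B -> False.
  by move=> fA fB; have := disjointFr dAB fA; rewrite fB.
have /safeP[hxx hvx hvsx hv hs hx hxsu husu hss hsw] := sAB.
have card3 (f g h : {set 'I_n}) : #|[set f; g; h]| <= 3.
  by rewrite -setUA !cardsU1 cards1; do 2!case: (_ \notin _).
have sub3 f g h : f \in edges n -> g \in edges n -> h \in edges n ->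
    [set f; g; h] \subset edges n by rewrite !subUset !sub1set => -> -> ->.
have dis3 f g h : f \notin e |: A -> g \notin e |: A -> h \notin e |: A ->
    [disjoint [set f; g; h] & e |: A].
  move=> fA gA hA.
  by rewrite disjoints_subset !subUset !sub1set !in_setC fA gA hA.
have safeU D := safe_setU1 sAB (subsetUl B D) AE eE eB.
have [u [w [eE' uw wv]]] : exists u, exists w,
    [/\ e = [set u; w], u != w & w != v].
  have /cards2P[u [w [uw ee]]] : #|e| == 2 by move: eE; rewrite inE.
  have [wv|wv] := eqVneq w v; last by exists u, w.
  by exists w, u; rewrite setUC -wv eq_sym.
have neq := distinct5.
have notin f : (f \in A -> False) -> (f == e) = false -> f \notin e |: A.
  by move=> /negP fA fe; rewrite in_setU1 fe.
have edge a b : (a == b) = false -> [set a; b] \in edges n.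
  by rewrite edgeE => ->.
(* An edge [{v, w}]: the answers are the three conclusions of the rule for [v]. *)
have [uv|uNv] := eqVneq u v.
  subst u e; have wx : w != x by apply: contraNneq eB => ->.
  have wsx : w != s x by apply: contraNneq eB => ->.
  have {}neq := neq _ _ xNv wv wx wsx.
  exists [set [set v; s w]; [set w; s w]; [set x; s w]]; split=> //.
  - by apply: sub3; apply: edge; rewrite neq.
  - apply: dis3; apply: notin; rewrite ?set2_eq ?eqxx ?neq //.
    + by case/hv; rewrite sK (negPf eB).
    + by move/hs; rewrite (negPf eB).
    + by move/hx; rewrite sK (negPf eB).
  have nos a : [set v; w] = [set a; s a] -> False.
    move=> /eqP; rewrite set2_eq => /orP[]/andP[].
      by move=> /eqP<-; rewrite sv neq.
    by move=> /[swap] /eqP<-; rewrite neq.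
  apply: safeU => [a /eqP|a /nos|a /eqP|a /nos|a b /eqP] //.
  - rewrite set2_eq eqxx !neq andbF orbF => /eqP<-.
    by rewrite !inE !eqxx ?orbT.
  - by rewrite set2_eq !neq andbF.
  - by rewrite set2_eq => /orP[]/andP[/eqP<- /eqP<-]; rewrite ?eqxx.
have [wE|wNu] := eqVneq w (s u).
  subst w e.
  have [ux usx] : u != x /\ u != s x.
    split; apply: contraNneq eA => ->; first exact: hxx.
    by rewrite sK setUC.
  have {}neq := neq _ _ xNv uNv ux usx.
  (* An edge [{u, s u}] threatens [{v, u}] and [{v, s u}]. At most one of [{x, u}], [{x, s u}] is
     red, as both together would make [e] blue, and then the other one is the third threat [z]. If
     neither is red, [z] repeats [{v, u}] as a filler. *)
  have [z [zE zA z1 z2]] : exists z, [/\ z \in edges n,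
      z \notin [set u; s u] |: A,
      [set x; u] \in A -> z = [set x; s u]
      & [set x; s u] \in A -> z = [set x; u]].
    have [xuA|xuA] := boolP ([set x; u] \in A).
      have xsuA : [set x; s u] \in A -> False.
        by move/(hxsu _ xuA); rewrite (negPf eB).
      exists [set x; s u]; split=> //; first by apply: edge; rewrite neq.
      by apply: notin; rewrite ?set2_eq ?eqxx ?neq.
    have [xsuA|xsuA] := boolP ([set x; s u] \in A).
      exists [set x; u]; split=> //; first by apply: edge; rewrite neq.
        by apply: notin; rewrite ?set2_eq ?eqxx ?neq //; apply/negP.
    exists [set v; u]; split=> //; first by apply: edge; rewrite neq.
      apply: notin; rewrite ?set2_eq ?eqxx ?neq //.
      by case/hv; rewrite (negPf eB).
  exists [set [set v; u]; [set v; s u]; z]; split=> //.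
  - by apply: sub3 => //; apply: edge; rewrite neq.
  - apply: dis3 => //; apply: notin; rewrite ?set2_eq ?eqxx ?neq //.
    + by case/hv; rewrite (negPf eB).
    + by case/hv; rewrite sK (setUC [set s u]) (negPf eB).
  have isu a : [set u; s u] = [set a; s a] -> a = u \/ a = s u.
    move=> /eqP; rewrite set2_eq => /orP[]/andP[].
      by move=> /eqP->; left.
    by move=> _ /eqP->; right.
  apply: safeU => [a /eqP|a /isu[]->|a /eqP|a /isu[]->|a b /eqP].
  - by rewrite set2_eq !neq ?andbF.
  - by rewrite !inE eqxx ?orbT.
  - by rewrite !inE eqxx ?orbT.
  - by rewrite set2_eq !neq ?andbF.
  - by move=> /z1-> _; rewrite !inE eqxx ?orbT.
  - by move=> /z2-> _; rewrite sK !inE eqxx ?orbT.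
  - by rewrite set2_eq => /orP[]/andP[/eqP<- /eqP<-] _ _ _; rewrite ?sK eqxx.
have wu : w != u by rewrite eq_sym.
have xcase : (exists b, [/\ e = [set x; b], b != x, b != v & b != s x]) \/
    (u != x /\ w != x).
  have [ux|ux] := eqVneq u x; first by left; exists w; rewrite -ux.
  have [wx|wx] := eqVneq w x; last by right.
  left; exists u; rewrite -wx setUC; split=> //.
  by rewrite -s_eqC eq_sym.
case: xcase => [[b [eb bx bv bsx]]|[ux wx]].
  clear u w eE' uw wv uNv wNu wu; subst e.
  have {}neq := neq _ _ xNv bv bx bsx.
  have vsbA : [set v; s b] \notin [set x; b] |: A.
    apply: notin; rewrite ?set2_eq ?eqxx ?neq //.
    by case/hv; rewrite sK (negPf eB).
  have sxbA : [set s x; b] \notin [set x; b] |: A.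
    apply: notin; rewrite ?set2_eq ?eqxx ?neq //.
    by move=> /hsw; rewrite sK (negPf eB) !neq => /(_ isT isT isT isT).
  have sxsbA : [set s x; s b] \notin [set x; b] |: A.
    apply: notin; rewrite ?set2_eq ?eqxx ?neq ?andbF //.
    by move=> /hss; rewrite !sK (negPf eB) !neq => /(_ isT isT isT).
  (* Each of these two red edges adds a threat to the basic three of [{x, b}]. Both together would
     have made [{x, b}] blue. *)
  have xsb : [set x; s b] \in A -> [set s b; b] \in A -> False.
    move=> h1 h2; have := husu _ h1.
    by rewrite sK h2 neq (negPf eB) => /(_ isT isT).
  have block D : #|D| <= 3 -> D \subset edges n ->
      [disjoint D & [set x; b] |: A] ->
      [/\ [set v; s b] \in B :|: D,
        [set x; s b] \in A -> [set b; s b] \in B :|: D,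
        [set b; s b] \in A -> [set x; s b] \in B :|: D,
        [set s x; s b] \in B :|: D & [set s x; b] \in B :|: D] ->
      exists D, [/\ #|D| <= 3, D \subset edges n, [disjoint D & [set x; b] |: A]
        & safe ([set x; b] |: A) (B :|: D)].
    move=> D3 DE DA [c1 c2 c3 c4 c5]; exists D; split=> //.
    have nos a : [set x; b] = [set a; s a] -> False.
      move=> /eqP; rewrite set2_eq => /orP[]/andP[].
        by move=> /eqP<-; rewrite neq.
      by move=> /[swap] /eqP<-; rewrite neq.
    apply: safeU => [a /eqP|a /nos|a /eqP|a /nos|a c /eqP] //.
    - by rewrite set2_eq !neq ?andbF.
    - by rewrite set2_eq eqxx !neq andbF orbF => /eqP<-.
    - rewrite set2_eq => /orP[]/andP[/eqP<- /eqP<-] _ _ _ _ //.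
      by rewrite setUC eqxx.
  (* With [{b, s b}] red, [{x, s b}] is a fourth threat, but [{v, s b}] is already blue. *)
  have [bA|bA] := boolP ([set b; s b] \in A).
    have vsb : [set v; s b] \in B by apply: hs; rewrite sK setUC.
    have xsbA : [set x; s b] \notin [set x; b] |: A.
      apply: notin; rewrite ?set2_eq ?eqxx ?neq // => /xsb; apply.
      by rewrite setUC.
    apply: (block [set [set x; s b]; [set s x; s b]; [set s x; b]]) => //.
    - by apply: sub3; apply: edge; rewrite neq.
    - exact: dis3.
    - rewrite !inE vsb !eqxx ?orbT; split=> // h; case: (xsb h).
      by rewrite setUC.
  (* With [{x, s b}] red, [{b, s b}] is a fourth threat, but [{s x, b}] and [{s x, s b}] are already
     blue; the former only fills up [D]. *)
  have [xA|xA] := boolP ([set x; s b] \in A).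
    have sxb : [set s x; b] \in B.
      by have := hss _ _ xA; rewrite sK !neq; apply.
    have sxsb : [set s x; s b] \in B.
      by have := hsw _ _ xA; rewrite (inj_eq s_inj) !neq; apply.
    apply: (block [set [set v; s b]; [set b; s b]; [set s x; b]]) => //.
    - by apply: sub3; apply: edge; rewrite neq.
    - apply: dis3 => //; apply: notin; rewrite ?set2_eq ?eqxx ?neq //.
      exact/negP.
    - by rewrite !inE sxb sxsb !eqxx ?orbT (negPf bA).
  apply: (block [set [set v; s b]; [set s x; s b]; [set s x; b]]) => //.
  - by apply: sub3; apply: edge; rewrite neq.
  - exact: dis3.
  - by rewrite !inE !eqxx ?orbT (negPf xA) (negPf bA).
(* The generic edge avoids [v] and [x] and is no pair [{u, s u}]: the answers are the other three
   edges of its orbit under [s] at either end. *)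
subst e; have {}neq := neq _ _ uNv wv wu wNu.
exists [set [set s u; s w]; [set s u; w]; [set u; s w]]; split=> //.
- by apply: sub3; apply: edge; rewrite neq.
- apply: dis3; apply: notin; rewrite ?set2_eq ?eqxx ?neq ?andbF //.
  + by move=> /hss; rewrite !sK (negPf eB) !neq => /(_ isT isT isT).
  + by move=> /hsw; rewrite sK (negPf eB) !neq => /(_ isT isT isT wx).
  + rewrite setUC => /hsw; rewrite sK (setUC [set w]) (negPf eB) !neq.
    by rewrite ux => /(_ isT isT isT isT).
have nos a : [set u; w] = [set a; s a] -> False.
  move=> /eqP; rewrite set2_eq => /orP[]/andP[].
    by move=> /eqP<-; rewrite neq.
  by move=> /[swap] /eqP<-; rewrite neq.
apply: safeU => [a /eqP|a /nos|a /eqP|a /nos|a b /eqP] //.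
- by rewrite set2_eq !neq ?andbF.
- by rewrite set2_eq (negPf ux) (negPf wx) ?andbF.
rewrite set2_eq => /orP[]/andP[/eqP<- /eqP<-] _ _ _ _.
  by rewrite !inE !eqxx ?orbT.
by rewrite (setUC [set s w]) (setUC [set s w]) !inE !eqxx ?orbT.
Qed.

End Safe.

(** * Colours and legality as a history grows by one turn *)

Section Histories.
Variable n : nat.
Implicit Types h : history n.

Lemma bigcup_rcons (P : pred nat) h m :
  \bigcup_(i < size (rcons h m) | P i) nth set0 (rcons h m) i =
  (\bigcup_(i < size h | P i) nth set0 h i)
    :|: (if P (size h) then m else set0).
Proof.
rewrite size_rcons big_mkcond big_ord_recr -big_mkcond /=.
rewrite nth_rcons ltnn eqxx; congr (_ :|: _).
by apply: eq_bigr => i _; rewrite nth_rcons ltn_ord.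
Qed.

Lemma red_rcons h m :
  red (rcons h m) = if odd (size h) then red h else red h :|: m.
Proof.
rewrite /red (bigcup_rcons (fun i => ~~ odd i)).
by case: odd; rewrite ?setU0.
Qed.

Lemma blue_rcons h m :
  blue (rcons h m) = if odd (size h) then blue h :|: m else blue h.
Proof. by rewrite /blue bigcup_rcons; case: odd; rewrite ?setU0. Qed.

Lemma legal_rcons p q h m : legal_history p q (rcons h m) ->
  legal_history p q h /\ legal_move (if odd (size h) then q else p) h m.
Proof.
move=> H; split=> [i ih|].
  have := H i; rewrite size_rcons ltnS (ltnW ih) nth_rcons ih -cats1.
  by rewrite takel_cat ?(ltnW ih) //; apply.
have := H (size h); rewrite size_rcons ltnS leqnn nth_rcons ltnn eqxx.
by rewrite -cats1 take_size_cat //; apply.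
Qed.

Lemma follows_rcons s h m : player2_follows s (rcons h m) ->
  player2_follows s h /\ (odd (size h) -> m = s h).
Proof.
move=> H; split=> [i ih|].
  have := H i; rewrite size_rcons ltnS (ltnW ih) nth_rcons ih -cats1.
  by rewrite takel_cat ?(ltnW ih) //; apply.
have := H (size h); rewrite size_rcons ltnS leqnn nth_rcons ltnn eqxx.
by rewrite -cats1 take_size_cat //; apply.
Qed.

Lemma legal_colours p q h : legal_history p q h ->
  [/\ red h \subset edges n, blue h \subset edges n
    & [disjoint red h & blue h]].
Proof.
elim/last_ind: h => [_|h m IH /legal_rcons[/IH[rE bE d] /and3P[_ mU _]]].
  by rewrite /red /blue !big_ord0 !sub0set disjoints_subset sub0set.
rewrite red_rcons blue_rcons.
move: mU; rewrite /uncoloured subsetD disjoint_sym => /andP[mE].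
rewrite -setI_eq0 setIUl setU_eq0 !setI_eq0 => /andP[mr mb].
by case: odd; rewrite ?subUset ?rE ?bE ?mE; split=> //;
  rewrite -setI_eq0 ?setIUl ?setIUr setU_eq0 !setI_eq0 ?d // disjoint_sym.
Qed.

End Histories.

(** * Filling up a move, choosing the involution, and the opening *)

(** Bob must colour an exact number of edges, possibly more than there are threats; this supplies
    the spare ones. *)
Lemma subset_extend (T : finType) (k : nat) (m U : {set T}) :
  m \subset U -> #|m| <= k <= #|U| ->
  exists m' : {set T}, [/\ m \subset m', m' \subset U & #|m'| = k].
Proof.
move=> mU /andP[mk kU]; elim: k mk kU => [|k IH].
  by rewrite leqn0 => mk _; exists m; split=> //; apply/eqP.
rewrite leq_eqVlt => /orP[/eqP<- _|mk kU]; first by exists m.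
have [m' [mm' m'U m'k]] := IH mk (ltnW kU).
have /card_gt0P[z] : 0 < #|U :\: m'|.
  by rewrite cardsDS // subn_gt0 m'k.
rewrite inE => /andP[zm' zU]; exists (z |: m'); split.
- exact: subset_trans mm' (subsetUr _ _).
- by rewrite subUset sub1set zU.
- by rewrite cardsU1 zm' m'k.
Qed.

(* t is the triple (v, x, s). *)
Definition frame n (e : {set 'I_n}) (t : 'I_n * 'I_n * ('I_n -> 'I_n)) : Prop :=
  [/\ involutive t.2, forall u, (t.2 u == u) = (u == t.1.1),
      t.1.2 != t.1.1 & e = [set t.1.2; t.2 t.1.2]].

(** Reversing an odd number of ordinals fixes only the middle one and swaps the two extremes.
    Conjugating by a permutation that takes the extremes to the ends of [e] gives [s]. *)
Lemma exists_frame n : odd n -> 1 < n ->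
  exists f, forall e : {set 'I_n}, e \in edges n -> frame e (f e).
Proof.
case: n => [//|n]; rewrite /= => n_even n_gt0.
apply: (@fin_all_exists _ (fun=> _)
  (fun e t => e \in edges n.+1 -> frame e t)) => e.
(* Sets that are not edges receive an arbitrary triple. *)
have [eE|] := boolP (e \in edges _); last by exists (ord0, ord0, id).
have /cards2P[x [y [xy ->]]] : #|e| == 2 by move: eE; rewrite inE.
have mid : n./2 < n.+1 by rewrite ltnS -divn2 leq_div.
have rev_fix (u : 'I_n.+1) : (rev_ord u == u) = (u == Ordinal mid).
  rewrite -!val_eqE /= subSS; have := ltn_ord u; rewrite ltnS => un.
  have n2 : n = n./2 + n./2 by rewrite addnn even_halfK.
  apply/eqP/eqP=> h.
    by have := congr1 half (subnK un); rewrite h addnn doubleK.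
  by rewrite h {1}n2 addnK.
have [p [p0 pm]] : exists p : {perm 'I_n.+1}, p ord0 = x /\ p ord_max = y.
  (* [c] is the preimage of [y] under the transposition that takes [ord0] to [x]. *)
  have [c cE] : exists c, y = tperm ord0 x c.
    by exists (tperm ord0 x y); rewrite tpermK.
  exists (tperm ord_max c * tperm ord0 x)%g; rewrite !permM tpermL -cE.
  have c0 : c != ord0 by apply: contraNneq xy => c0; rewrite cE c0 tpermL.
  have m0 : ord_max != ord0 :> 'I_n.+1 by rewrite -val_eqE /= -lt0n.
  by rewrite (tpermD m0 c0) tpermL.
exists (p (Ordinal mid), x, fun u => p (rev_ord (p^-1%g u))); split=> /=.
- by move=> u; rewrite permK rev_ordK permKV.
- move=> u; rewrite -{2}[u](permKV p) (inj_eq perm_inj) rev_fix.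
  by rewrite -[in RHS](permKV p u) (inj_eq perm_inj).
- rewrite -p0 (inj_eq perm_inj) -val_eqE /= eq_sym -lt0n half_gt0.
  by case: n n_even n_gt0 {eE x y xy mid rev_fix p p0 pm e} => [|[]].
- rewrite -p0 permK -pm; congr [set _; p _]; apply: val_inj => /=.
  by rewrite subSS subn0.
Qed.

(** The only threats of the first red edge are the edges from its two ends to [v]. *)
Lemma safe_opening n (v x : 'I_n) (s : 'I_n -> 'I_n) :
  involutive s -> (forall u, (s u == u) = (u == v)) -> x != v ->
  safe v x s [set [set x; s x]] [set [set v; x]; [set v; s x]].
Proof.
move=> sK s_fix xNv.
have sv : s v = v by apply/eqP; rewrite s_fix.
have vx : (v == x) = false by rewrite eq_sym (negPf xNv).
have vsx : (v == s x) = false.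
  by rewrite -{1}sv (inj_eq (can_inj sK)) vx.
apply/safeP; split; rewrite ?set11 ?set21 ?set22 //.
- by move=> u /set1P/eqP; rewrite set2_eq vx vsx.
- move=> u /set1P/eqP; rewrite set2_eq => /orP[]/andP[].
    by move=> /eqP->; rewrite set21.
  by move=> /eqP->; rewrite set22.
- move=> u /set1P/eqP; rewrite set2_eq eqxx /=.
  case/orP=> [/eqP->|/andP[_ /eqP->]]; first by rewrite sK set21.
  by rewrite set22.
- move=> u /set1P/eqP; rewrite set2_eq eqxx /= => /orP[/eqP->|].
    move=> /set1P/eqP; rewrite sK set2_eq eqxx [x == s x]eq_sym s_fix.
    by rewrite (negPf xNv).
  move=> /andP[]; rewrite eq_sym s_fix.
  by rewrite (negPf xNv).
- move=> u /set1P/eqP; rewrite set2_eq eqxx /= => /orP[/eqP->|].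
    by rewrite eqxx.
  move=> /andP[/eqP + /eqP ux]; rewrite ux => /esym/eqP; rewrite s_fix.
  by rewrite (negPf xNv).
- move=> u w /set1P/eqP; rewrite set2_eq => /orP[]/andP[/eqP-> /eqP->].
    by rewrite eqxx.
  by rewrite sK eqxx.
- move=> u w /set1P/eqP; rewrite set2_eq => /orP[]/andP[/eqP-> /eqP->].
    by rewrite eqxx.
  by rewrite sK eqxx.
Qed.

Lemma legal_move1 n (h : history n) m : legal_move 1 h m ->
  exists2 e, e \in uncoloured h & m = [set e].
Proof.
case/and3P=> U0 mU; rewrite (minn_idPl _) ?card_gt0 // => /cards1P[e me].
by exists e => //; rewrite -sub1set -me.
Qed.

(** * Bob's strategy and its invariant *)

Section Strategy.
Variables (n : nat) (f : {set 'I_n} -> 'I_n * 'I_n * ('I_n -> 'I_n)).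
Hypothesis f_frame : forall e : {set 'I_n}, e \in edges n -> frame e (f e).
Implicit Types h : history n.

(** The first move is a singleton, and [cover] extracts its edge, so the frame is recovered from the
    history alone. *)
Definition safe_after h (B : {set {set 'I_n}}) : bool :=
  let t := f (cover (nth set0 h 0)) in safe t.1.1 t.1.2 t.2 (red h) B.

Definition block_threats : strategy n := fun h =>
  odflt set0 [pick m | legal_move 3 h m && safe_after h (blue h :|: m)].

(** Bounding the size of [m], instead of fixing it, keeps the notion meaningful when no edge is
    left: then [m] is empty. *)
Definition blockable h : Prop :=
  exists m : {set {set 'I_n}},
    [/\ m \subset uncoloured h, #|m| <= 3 & safe_after h (blue h :|: m)].

Lemma block_threatsP h : blockable h -> uncoloured h != set0 ->
  legal_move 3 h (block_threats h) &&
  safe_after h (blue h :|: block_threats h).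
Proof.
move=> [m [mU m3 mS]] U0; rewrite /block_threats; case: pickP => [//|/=].
have [|m' [mm' m'U m'k]] := @subset_extend _ (minn 3 #|uncoloured h|) m _ mU.
  by rewrite leq_min m3 subset_leq_card // geq_minr.
have m'S : safe_after h (blue h :|: m') by apply: safe_mono mS; exact: setUS.
by move=> /(_ m'); rewrite /legal_move U0 m'U m'k eqxx m'S.
Qed.

(** Induction on the number of turns: the position is [blockable] when Bob is to move and safe when
    Alice is. Her first turn stands apart, as it fixes the frame. *)
Lemma block_threats_safe h : legal_history 1 3 h ->
  player2_follows block_threats h -> 0 < size h ->
  (exists2 e, e \in edges n & nth set0 h 0 = [set e]) /\
  (if odd (size h) then blockable h else safe_after h (blue h)).
Proof.
elim/last_ind: h => [//|h m IH] /legal_rcons[hl ml] /follows_rcons[hf mf] _.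
rewrite size_rcons /=; case: (posnP (size h)) => [/size0nil h0|h_gt0].
  subst h; have [e eU mE] := legal_move1 ml; rewrite {}mE in ml mf *.
  have eE : e \in edges n by case/setDP: eU.
  split; first by exists e.
  have := f_frame eE; rewrite /blockable /safe_after /= /cover big_set1.
  case: (f e) => [[v x] s] [/= sK s_fix xNv eq_e].
  have rE : red [:: [set e]] = [set e].
    by rewrite -[[:: _]]/(rcons [::] _) red_rcons /red big_ord0 set0U.
  have bE : blue [:: [set e]] = set0.
    by rewrite -[[:: _]]/(rcons [::] _) blue_rcons /blue big_ord0.
  have sv : s v = v by apply/eqP; rewrite s_fix.
  have vx : (v == x) = false by rewrite eq_sym (negPf xNv).
  have vsx : (v == s x) = false by rewrite -{1}sv (inj_eq (can_inj sK)) vx.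
  exists [set [set v; x]; [set v; s x]]; split.
  - rewrite /uncoloured rE bE setU0 subUset !sub1set !in_setD !edgeE !inE.
    by rewrite eq_e !set2_eq vx vsx.
  - by rewrite cardsU1 cards1; case: (_ \notin _).
  - by rewrite rE bE set0U eq_e; apply: safe_opening.
have n0 : nth set0 (rcons h m) 0 = nth set0 h 0 by rewrite nth_rcons h_gt0.
have [[e0 e0E h0] hS] := IH hl hf h_gt0.
rewrite n0; split; first by exists e0.
have [rE bE dAB] := legal_colours hl.
case: ifP hS ml mf => o hS ml mf.
  have U0 : uncoloured h != set0 by case/and3P: ml.
  rewrite /safe_after n0 red_rcons blue_rcons o mf //.
  by case/andP: (block_threatsP hS U0).
have [e eU mE] := legal_move1 ml.
have := f_frame e0E; move: hS; rewrite /blockable /safe_after n0 h0.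
rewrite /cover big_set1 /uncoloured red_rcons blue_rcons o mE.
case: (f e0) => [[v x] s] /= hS [/= sK s_fix xNv _].
move: eU; rewrite !inE negb_or => /andP[/andP[er eb] eE].
have eE' : e \in edges n by rewrite inE.
have [D [D3 DE DA DS]] := safe_step sK s_fix xNv dAB rE eE' er eb hS.
(* Some answers may be blue already; only the others remain to be coloured. *)
exists (D :\: blue h); split.
- apply/subsetP=> g /setDP[gD gb]; rewrite in_setD in_setU (setUC (red h)).
  by rewrite (disjointFr DA gD) (negPf gb) (subsetP DE).
- exact: leq_trans (subset_leq_card (subsetDl _ _)) D3.
- suff -> : blue h :|: D :\: blue h = blue h :|: D by rewrite setUC.
  by apply/setP=> g; rewrite !inE; case: (g \in blue h).
Qed.

End Strategy.

Theorem theorem4p2 (n : nat) (n_odd : odd n) (n_ge5 : 5 <= n) :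
  clique_game_won_by_player2 1 3 n.
Proof.
have [f f_frame] := exists_frame n_odd (leq_trans (isT : 1 < 5) n_ge5).
exists (block_threats f) => [h hl hf ho|h hl hf U0].
  have [_] := block_threats_safe f_frame hl hf (odd_gt0 ho).
  by rewrite ho => hb U0; case/andP: (block_threatsP hb U0).
have [rE bE dAB] := legal_colours hl.
have AB : red h :|: blue h = edges n.
  apply/eqP; rewrite eqEsubset subUset rE bE /=.
  by rewrite -setD_eq0; apply/eqP.
(* The invariant needs a first move, and there is one because the graph has an edge. *)
have h_gt0 : 0 < size h.
  rewrite lt0n; apply: contraTneq n_ge5 => /size0nil h0.
  move: AB; rewrite h0 /red /blue !big_ord0 setU0 => /esym/setP E.
  case: n {n_odd f f_frame h hl hf U0 rE bE dAB h0} E => [|[|k]] // E.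
  by have := E [set ord0; ord_max]; rewrite edgeE inE.
have [[e eE he] hS] := block_threats_safe f_frame hl hf h_gt0.
have [sK s_fix xNv _] := f_frame e eE.
apply: (safe_win sK s_fix xNv) => //.
(* If Alice moved last, nothing is left for Bob to colour, so the set that [blockable] provides is
   empty and the position is already safe. *)
move: hS; rewrite /blockable /safe_after he /cover big_set1.
case: odd => //= -[m []]; rewrite U0 subset0 => /eqP-> _.
by rewrite setU0.
Qed.
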